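(* Fix a free ultrafilter $\mathcal{U}$ on $\mathbb{N}$. Let $(M_i)_{i \in \mathbb{N}}$ be a sequence of separable tracial von Neumann algebras and let $\mathcal{M} = \prod_{i \to \mathcal{U}} M_i$. Suppose $\alpha: \mathcal{M} \to \mathcal{M}$ is a trace-preserving automorphism that lifts to a uniformly bounded sequence of positive maps $\phi^i : M_i \to M_i$. Then $\alpha$ can also be lifted to a uniformly bounded sequence of normal positive maps $M_i \to M_i$.
   Context: A tracial von Neumann algebra is a von Neumann algebra $M$ with a fixed faithful normal tracial state $\tau_M$; $\|x\|_2 = \tau_M(x^*x)^{1/2}$. Separable means separable with respect to $\|\cdot\|_2$ (equivalently, separable predual). The tracial ultraproduct $\prod_{i \to \mathcal{U}} M_i$ is the quotient of the algebra of sequences $(x_i)_{i} \in \prod_i M_i$ with $\sup_i \|x_i\| < \infty$ (operator norm) by the ideal of those with $\lim_{i \to \mathcal{U}} \|x_i\|_2 = 0$, with trace $\tau_{\mathcal{U}}([x_i]_i) = \lim_{i \to \mathcal{U}} \tau_{M_i}(x_i)$; $[x_i]_i$ denotes the class of $(x_i)_i$. The map $\alpha$ lifts to a sequence of maps $\phi^i: M_i \to M_i$ if $\alpha([x_i]_i) = [\phi^i(x_i)]_i$ for every $(x_i)_i \in \prod_i M_i$ with $\sup_i \|x_i\| < \infty$. Positive maps are linear; a sequence $(\phi^i)_i$ is uniformly bounded if $\sup_i \|\phi^i\| < \infty$, with $\|\phi^i\|$ the norm of $\phi^i$ as a map with respect to operator norms. *)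

(* Defs.v *)
From HB Require Import structures.
From mathcomp Require Import all_boot all_order all_algebra.
From mathcomp Require Import generic_quotient.
From mathcomp Require Import complex.
From mathcomp Require Import all_classical all_reals all_analysis.
From mathcomp Require Import ring lra.

Set Implicit Arguments.
Unset Strict Implicit.
Unset Printing Implicit Defensive.

Import Order.TTheory GRing.Theory Num.Theory.
Import numFieldNormedType.Exports.

Local Open Scope classical_set_scope.
Local Open Scope ring_scope.
Local Open Scope complex_scope.
Local Open Scope quotient_scope.

(* The inner product is linear in the first variable. *)
Record hilbertType (R : realType) := Hilbert {
  hilbert_sort :> completeNormedModType R[i];
  inner : {dot hilbert_sort for Num.conj};
  inner_norm : forall v, `|v| ^+ 2 = inner v v }.

(* Norms of [R[i]]-modules take their values in [R[i]]; this is the same norm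
   with values in [R]. *)
Definition rnorm (R : realType) (V : normedModType R[i]) (v : V) : R :=
  complex.Re `|v|.

Section Operators.
Variables (R : realType) (H : hilbertType R).
Implicit Types (S T : H -> H) (M : set (H -> H)).

Definition bounded_operator T :=
  (forall (a : R[i]) v w, T (a *: v + w) = a *: T v + T w) /\
  exists K : R, forall v, rnorm (T v) <= K * rnorm v.

Definition adjoint S T := forall v w, inner H (S v) w = inner H v (T w).

(* wot: the weak operator topology *)
Definition wot_closure M T :=
  forall (s : seq (H * H)) (e : R), 0 < e ->
    exists2 S, M S &
      forall p, p \in s -> `|inner H (T p.1 - S p.1) p.2| < e%:C.

Record von_neumann_algebra M : Prop := VonNeumannAlgebra {
  vna_bounded : M `<=` bounded_operator;
  vna_one : M id;
  vna_linear : forall (a : R[i]) S T, M S -> M T ->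
    M (fun v => a *: S v + T v);
  vna_mul : forall S T, M S -> M T -> M (S \o T);
  vna_adjoint : forall S, M S -> exists2 T, M T & adjoint S T;
  vna_closed : forall T, bounded_operator T -> wot_closure M T -> M T }.

Definition opnorm T : R := sup [set rnorm (T v) | v in [set v | rnorm v <= 1]].

End Operators.

(* A nonzero (as an [algType]) von Neumann algebra: a unital algebra with an
   identification, through the injective unital homomorphism [vn_op], with a
   von Neumann algebra of operators on a Hilbert space. The involution, order
   and norm are those of the operators. *)
Record vnAlgebra (R : realType) := VnAlgebra {
  vn_sort :> algType R[i];
  vn_space : hilbertType R;
  vn_op : vn_sort -> vn_space -> vn_space;
  vn_op_linear : forall (a : R[i]) x y v,
    vn_op (a *: x + y) v = a *: vn_op x v + vn_op y v;
  vn_op_mul : forall x y v, vn_op (x * y) v = vn_op x (vn_op y v);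
  vn_op_one : forall v, vn_op 1 v = v;
  vn_op_inj : injective vn_op;
  vn_op_range : von_neumann_algebra (range vn_op);
  star : vn_sort -> vn_sort;
  star_adjoint : forall x, adjoint (vn_op x) (vn_op (star x)) }.

Arguments vn_op {R} {_} _ _.
Arguments star {R} {_} _.

Section Order.
Variable R : realType.

Definition vnorm (M : vnAlgebra R) (x : M) : R := opnorm (vn_op x).

Definition vpos (M : vnAlgebra R) (x : M) :=
  forall v, 0 <= inner (vn_space M) (vn_op x v) v.

Definition vle (M : vnAlgebra R) (x y : M) := vpos (y - x).

Definition is_supremum T (le : T -> T -> Prop) (D : set T) (s : T) :=
  (forall x, D x -> le x s) /\
  forall u, (forall x, D x -> le x u) -> le s u.

Definition updirected T (le : T -> T -> Prop) (D : set T) :=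
  D !=set0 /\
  forall x y, D x -> D y -> exists z, [/\ D z, le x z & le y z].

(* Normality of a positive map: it preserves suprema of bounded increasing
   nets of self-adjoint elements; [le] is the order of the codomain. *)
Definition preserves_directed_sup (M : vnAlgebra R) T (le : T -> T -> Prop)
    (f : M -> T) :=
  forall (D : set M) (s : M),
    D `<=` [set x | star x = x] -> updirected (@vle M) D ->
    is_supremum (@vle M) D s -> is_supremum le (f @` D) (f s).

Definition positive_map (M N : vnAlgebra R) (f : M -> N) :=
  forall x, vpos x -> vpos (f x).

Definition normal_map (M N : vnAlgebra R) (f : M -> N) :=
  preserves_directed_sup (@vle N) f.

End Order.

Record tracialVNA (R : realType) := TracialVNA {
  tracial_alg :> vnAlgebra R;
  tr : {scalar tracial_alg};
  tr_ge0 : forall x, vpos x -> 0 <= tr x;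
  tr_one : tr 1 = 1;
  tr_faithful : forall x, vpos x -> tr x = 0 -> x = 0;
  tr_normal : preserves_directed_sup (fun a b : R[i] => a <= b) tr;
  tr_mulC : forall x y, tr (x * y) = tr (y * x) }.

Arguments tr {R} {_}.

Section TraceNorm.
Variable R : realType.

Definition norm2 (M : tracialVNA R) (x : M) : R :=
  Num.sqrt (complex.Re (tr (star x * x))).

Definition separable (M : tracialVNA R) :=
  exists d : nat -> M, forall (x : M) (e : R), 0 < e ->
    exists n, norm2 (x - d n) < e.

(* This says [sup_i ||phi i|| < oo], where [||phi i||] is the least [K] such that
   [||phi i x|| <= K ||x||] for all [x]. *)
Definition uniformly_bounded (M N : nat -> tracialVNA R)
    (phi : forall i, M i -> N i) :=
  exists K : R, forall i (x : M i), vnorm (phi i x) <= K * vnorm x.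

End TraceNorm.

Section Estimates.
Variable R : realType.

Lemma rnormE (V : normedModType R[i]) (v : V) : `|v| = (rnorm v)%:C.
Proof. by rewrite /rnorm RRe_real// normr_real. Qed.

Lemma rnorm_ge0 (V : normedModType R[i]) (v : V) : 0 <= rnorm v.
Proof. by rewrite -(@ler0c R) -rnormE. Qed.

Lemma rnormD (V : normedModType R[i]) (v w : V) :
  rnorm (v + w) <= rnorm v + rnorm w.
Proof. by rewrite -lecR rmorphD/= -!rnormE ler_normD. Qed.

Lemma rnormZ (V : normedModType R[i]) (a : R[i]) (v : V) :
  rnorm (a *: v) = complex.Re `|a| * rnorm v.
Proof.
by apply: (@complexI R); rewrite rmorphM/= -!rnormE normrZ.
Qed.

Lemma rnorm0 (V : normedModType R[i]) : rnorm (0 : V) = 0.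
Proof. by rewrite /rnorm normr0. Qed.

Lemma rnorm_eq0 (V : normedModType R[i]) (v : V) : rnorm v = 0 -> v = 0.
Proof. by move=> v0; apply/eqP; rewrite -normr_eq0 rnormE v0. Qed.


Section Inner.
Variable H : hilbertType R.
Implicit Types v w : H.

Lemma innerC v w : inner H v w = (inner H w v)^*.
Proof. by rewrite hermC expr0 mul1r. Qed.

Lemma inner_rnorm v : inner H v v = (rnorm v ^+ 2)%:C.
Proof. by rewrite -inner_norm rnormE rmorphXn. Qed.

Lemma innerDl v w z : inner H (v + w) z = inner H v z + inner H w z.
Proof. exact: linearDl. Qed.

Lemma innerNl v z : inner H (- v) z = - inner H v z.
Proof. exact: linearNl. Qed.

Lemma innerZl (a : R[i]) v z : inner H (a *: v) z = a * inner H v z.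
Proof. by rewrite linearZl. Qed.

Lemma innerDr v w z : inner H z (v + w) = inner H z v + inner H z w.
Proof. exact: linearDr. Qed.

Lemma innerNr v z : inner H z (- v) = - inner H z v.
Proof. exact: linearNr. Qed.

Lemma innerZr (a : R[i]) v z : inner H z (a *: v) = a^* * inner H z v.
Proof. by rewrite linearZr. Qed.

Lemma inner0l z : inner H 0 z = 0.
Proof. exact: linear0l. Qed.

Lemma inner0r z : inner H z 0 = 0.
Proof. by rewrite innerC inner0l rmorph0. Qed.

Lemma inner_extl v w : (forall z, inner H v z = inner H w z) -> v = w.
Proof.
move=> vw; apply/eqP; rewrite -subr_eq0; apply/eqP/rnorm_eq0/eqP.
rewrite -sqrf_eq0 -(inj_eq (@complexI R)) -inner_rnorm innerDl innerNl vw.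
by rewrite subrr.
Qed.

Lemma re_innerC v w : complex.Re (inner H v w) = complex.Re (inner H w v).
Proof. by rewrite innerC; case: (inner H w v). Qed.

Lemma rnorm_sqE v : rnorm v ^+ 2 = complex.Re (inner H v v).
Proof. by rewrite inner_rnorm. Qed.

Lemma re_inner_le v w : complex.Re (inner H v w) <= rnorm v * rnorm w.
Proof.
have [v0|v0] := eqVneq (rnorm v) 0.
  by rewrite (rnorm_eq0 v0) inner0l rnorm0 mul0r.
have [w0|w0] := eqVneq (rnorm w) 0.
  by rewrite (rnorm_eq0 w0) inner0r rnorm0 mulr0.
have ab : 0 < rnorm v * rnorm w.
  by rewrite mulr_gt0// lt_neqAle eq_sym ?v0 ?w0 rnorm_ge0.
have := sqr_ge0 (rnorm ((rnorm w)%:C *: v - (rnorm v)%:C *: w)).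
rewrite rnorm_sqE innerDl !innerDr !innerNl !innerNr !innerZl !innerZr.
rewrite !inner_rnorm (innerC w v) /=.
case: (inner H v w) => a b /=; move: ab.
set p := rnorm v; set q := rnorm w => ab h.
rewrite -(ler_pM2l ab); nra.
Qed.

End Inner.

Section Opnorm.
Variable M : vnAlgebra R.
Implicit Types x y : M.

Lemma vn_op_bounded x : bounded_operator (vn_op x).
Proof. by apply: (vna_bounded (vn_op_range M)); exists x. Qed.

Lemma vnorm_has_sup x :
  has_sup [set rnorm (vn_op x v) | v in [set v | rnorm v <= 1]].
Proof.
split; first by exists (rnorm (vn_op x 0)), 0 => //=; rewrite rnorm0.
have [_ [K hK]] := vn_op_bounded x.
exists `|K| => _ [v /= v1 <-].
apply: le_trans (hK v) _; rewrite -[leRHS]mulr1.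
apply: le_trans (ler_wpM2r (rnorm_ge0 v) (ler_norm K)) _.
by rewrite ler_wpM2l.
Qed.

Lemma vn_op0r x : vn_op x 0 = 0.
Proof.
have [lin _] := vn_op_bounded x.
by have := lin (-1) 0 0; rewrite scaler0 addr0 scaleN1r addNr.
Qed.

Lemma vn_opZr x a v : vn_op x (a *: v) = a *: vn_op x v.
Proof.
by have [lin _] := vn_op_bounded x; rewrite -[a *: v]addr0 lin vn_op0r addr0.
Qed.

Lemma vn_op0l v : vn_op (0 : M) v = 0.
Proof.
by have := vn_op_linear (-1) (0 : M) 0 v; rewrite scaler0 addr0 scaleN1r addNr.
Qed.

Lemma vn_opDl x y v : vn_op (x + y) v = vn_op x v + vn_op y v.
Proof. by rewrite -[x]scale1r vn_op_linear !scale1r. Qed.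

Lemma vn_opZl a x v : vn_op (a *: x) v = a *: vn_op x v.
Proof. by rewrite -[a *: x]addr0 vn_op_linear vn_op0l addr0. Qed.

Lemma vn_opNl x v : vn_op (- x) v = - vn_op x v.
Proof. by rewrite -scaleN1r vn_opZl scaleN1r. Qed.

Lemma vnorm_ge0 x : 0 <= vnorm x.
Proof.
apply: le_trans (rnorm_ge0 (vn_op x 0)) _.
by apply: sup_upper_bound (vnorm_has_sup x) _ _; exists 0; rewrite /= ?rnorm0.
Qed.

Lemma vnorm_le x v : rnorm (vn_op x v) <= vnorm x * rnorm v.
Proof.
have [v0|v0] := eqVneq (rnorm v) 0.
  by rewrite (rnorm_eq0 v0) vn_op0r rnorm0 mulr0.
have vp : 0 < rnorm v by rewrite lt_neqAle eq_sym v0 rnorm_ge0.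
have hn : complex.Re `|((rnorm v)^-1)%:C : R[i]| = (rnorm v)^-1.
  by rewrite ger0_norm// ler0c invr_ge0 ltW.
have : rnorm (vn_op x (((rnorm v)^-1)%:C *: v)) <= vnorm x.
  apply: sup_upper_bound (vnorm_has_sup x) _ _.
  by exists (((rnorm v)^-1)%:C *: v) => //=; rewrite rnormZ hn mulVf.
by rewrite vn_opZr rnormZ hn mulrC ler_pdivrMr.
Qed.

Lemma vnorm_le_bound x (K : R) : 0 <= K ->
  (forall v, rnorm (vn_op x v) <= K * rnorm v) -> vnorm x <= K.
Proof.
move=> K0 hK; apply: sup_le_ub; first by have [] := vnorm_has_sup x.
move=> _ [v /= v1 <-]; apply: le_trans (hK v) _.
by rewrite -[leRHS]mulr1 ler_wpM2l.
Qed.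

Lemma vnorm1 : vnorm (1 : M) <= 1.
Proof. by apply: vnorm_le_bound => // v; rewrite vn_op_one mul1r. Qed.

Lemma vnorm0 : vnorm (0 : M) <= 0.
Proof. by apply: vnorm_le_bound => // v; rewrite vn_op0l rnorm0 mul0r. Qed.

Lemma vnormD x y : vnorm (x + y) <= vnorm x + vnorm y.
Proof.
apply: vnorm_le_bound => [|v]; first by rewrite addr_ge0 ?vnorm_ge0.
rewrite vn_opDl mulrDl; apply: le_trans (rnormD _ _) _.
by rewrite lerD ?vnorm_le.
Qed.

Lemma vnormZ a x : vnorm (a *: x) <= complex.Re `|a| * vnorm x.
Proof.
have a0 : 0 <= complex.Re `|a| by rewrite -(@ler0c R) RRe_real ?normr_real ?normr_ge0.
apply: vnorm_le_bound => [|v]; first by rewrite mulr_ge0 ?vnorm_ge0.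
by rewrite vn_opZl rnormZ -mulrA ler_wpM2l ?vnorm_le.
Qed.

Lemma vnormN x : vnorm (- x) <= vnorm x.
Proof.
apply: vnorm_le_bound => [|v]; first exact: vnorm_ge0.
by rewrite vn_opNl -scaleN1r rnormZ normrN1 mul1r vnorm_le.
Qed.

Lemma vnormM x y : vnorm (x * y) <= vnorm x * vnorm y.
Proof.
apply: vnorm_le_bound => [|v]; first by rewrite mulr_ge0 ?vnorm_ge0.
rewrite vn_op_mul -mulrA; apply: le_trans (vnorm_le _ _) _.
by rewrite ler_wpM2l ?vnorm_ge0 ?vnorm_le.
Qed.

Lemma vnorm_star x : vnorm (star x) <= vnorm x.
Proof.
apply: vnorm_le_bound => [|v]; first exact: vnorm_ge0.
set w := vn_op (star x) v.
have [->|w0] := eqVneq (rnorm w) 0; first by rewrite mulr_ge0 ?vnorm_ge0 ?rnorm_ge0.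
have wp : 0 < rnorm w by rewrite lt_neqAle eq_sym w0 rnorm_ge0.
rewrite -(ler_pM2r wp) -expr2 rnorm_sqE {1}/w re_innerC -star_adjoint.
apply: le_trans (re_inner_le _ _) _.
by rewrite [leRHS]mulrAC ler_wpM2r ?rnorm_ge0 ?vnorm_le.
Qed.

Lemma vn_ext x y : (forall v w, inner _ (vn_op x v) w = inner _ (vn_op y v) w) ->
  x = y.
Proof.
by move=> xy; apply: (@vn_op_inj R M); apply/funext => v; apply: inner_extl.
Qed.

Lemma star_adjointC x v w :
  inner _ (vn_op (star x) v) w = inner _ v (vn_op x w).
Proof. by rewrite innerC -star_adjoint -innerC. Qed.

Lemma starK : involutive (@star R M).
Proof. by move=> x; apply: vn_ext => v w; rewrite star_adjointC -star_adjoint. Qed.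

Lemma starM x y : star (x * y) = star y * star x.
Proof.
by apply: vn_ext => v w; rewrite star_adjointC !vn_op_mul !star_adjointC.
Qed.

Lemma starD x y : star (x + y) = star x + star y.
Proof.
apply: vn_ext => v w.
by rewrite star_adjointC !vn_opDl innerDr innerDl !star_adjointC.
Qed.

Lemma starZ a x : star (a *: x) = a^* *: star x.
Proof.
apply: vn_ext => v w.
by rewrite star_adjointC !vn_opZl innerZr innerZl !star_adjointC.
Qed.

Lemma starN x : star (- x) = - star x.
Proof. by rewrite -scaleN1r starZ rmorphN1 scaleN1r. Qed.

Lemma star1 : star (1 : M) = 1.
Proof. by rewrite -[RHS]starK -[X in _ = star X]mulr1 starM starK mulr1. Qed.

Lemma vpos_star_mul x : vpos (star x * x).
Proof.
by move=> v; rewrite vn_op_mul star_adjointC inner_rnorm ler0c sqr_ge0.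
Qed.

Lemma vpos_mul_bound x y :
  vpos (((vnorm x) ^+ 2)%:C *: (star y * y) - star (x * y) * (x * y)).
Proof.
move=> v; rewrite vn_opDl vn_opNl vn_opZl innerDl innerNl innerZl.
rewrite !vn_op_mul !star_adjointC vn_op_mul !inner_rnorm -rmorphM -rmorphB ler0c /=.
by rewrite subr_ge0 -exprMn ler_sqr ?nnegrE ?mulr_ge0 ?rnorm_ge0 ?vnorm_ge0 ?vnorm_le.
Qed.

End Opnorm.

Section Trace.
Variable M : tracialVNA R.
Implicit Types x y : M.

Definition sqnorm2 x : R := complex.Re (tr (star x * x)).

Lemma tr_star_mul x : tr (star x * x) = (sqnorm2 x)%:C.
Proof. by rewrite /sqnorm2 RRe_real// ger0_real ?tr_ge0 //; exact: vpos_star_mul. Qed.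

Lemma sqnorm2_ge0 x : 0 <= sqnorm2 x.
Proof. by rewrite -(@ler0c R) -tr_star_mul tr_ge0 //; exact: vpos_star_mul. Qed.

Lemma sqnorm2_0 : sqnorm2 0 = 0.
Proof. by rewrite /sqnorm2 mulr0 linear0. Qed.

Lemma sqnorm2_1 : sqnorm2 1 = 1.
Proof. by rewrite /sqnorm2 mulr1 star1 tr_one. Qed.

Lemma sqnorm2N x : sqnorm2 (- x) = sqnorm2 x.
Proof. by rewrite /sqnorm2 starN mulrNN. Qed.

Lemma sqnorm2_star x : sqnorm2 (star x) = sqnorm2 x.
Proof. by rewrite /sqnorm2 starK tr_mulC. Qed.

Lemma sqnorm2D x y : sqnorm2 (x + y) <= 2 * sqnorm2 x + 2 * sqnorm2 y.
Proof.
have := sqnorm2_ge0 (x - y); rewrite -(@ler0c R) => h0.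
rewrite -lecR !(rmorphD, rmorphM)/= -subr_ge0; apply: le_trans h0 _.
rewrite le_eqVlt; apply/orP; left; apply/eqP; rewrite -!tr_star_mul.
by rewrite !starD starN !mulrDl !mulrDr !mulrN !mulNr !linearD !linearN /=; ring.
Qed.

Lemma sqnorm2Ml x y : sqnorm2 (x * y) <= vnorm x ^+ 2 * sqnorm2 y.
Proof.
have := tr_ge0 (vpos_mul_bound x y).
rewrite linearB linearZ /= !tr_star_mul.
by rewrite -rmorphM -rmorphB ler0c subr_ge0.
Qed.

Lemma sqnorm2Mr x y : sqnorm2 (x * y) <= vnorm y ^+ 2 * sqnorm2 x.
Proof.
rewrite -sqnorm2_star starM; apply: le_trans (sqnorm2Ml _ _) _.
rewrite sqnorm2_star ler_wpM2r ?sqnorm2_ge0// ler_sqr ?nnegrE ?vnorm_ge0//.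
exact: vnorm_star.
Qed.

Lemma sqnorm2Z a x : sqnorm2 (a *: x) = complex.Re `|a| ^+ 2 * sqnorm2 x.
Proof.
have na : (complex.Re `|a| ^+ 2)%:C = a * a^*.
  transitivity ((complex.Re `|a|)%:C ^+ 2); first exact: rmorphXn.
  by rewrite RRe_real ?normr_real// normCK.
apply: (@complexI R); transitivity ((complex.Re `|a| ^+ 2)%:C * (sqnorm2 x)%:C).
  rewrite na -!tr_star_mul starZ -scalerAl -scalerAr scalerA linearZ /=.
  by rewrite [a * _]mulrC.
by symmetry; exact: rmorphM.
Qed.

Lemma tr_le_sqnorm2 x : complex.Re `|tr x| ^+ 2 <= sqnorm2 x.
Proof.
have P (s : R[i]) :
    0 <= (sqnorm2 x)%:C - s * tr (star x) - s^* * tr x + s^* * s.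
  have := tr_ge0 (vpos_star_mul (x - s *: 1)).
  rewrite starD starN starZ star1 mulrDl !mulrDr !mulrN !mulNr opprK.
  rewrite -!scalerAl -!scalerAr scalerA !mul1r !mulr1.
  rewrite !linearD !linearN !linearZ /= tr_one tr_star_mul mulr1.
  move=> h; apply: le_trans h _; rewrite le_eqVlt; apply/orP; left.
  apply/eqP; ring.
have -> : complex.Re `|tr x| ^+ 2 =
    complex.Re (tr x) ^+ 2 + complex.Im (tr x) ^+ 2.
  apply: (@complexI R); transitivity ((complex.Re `|tr x|)%:C ^+ 2).
    exact: rmorphXn.
  by rewrite RRe_real ?normr_real// add_Re2_Im2.
have := P 1; have := P 'i; have := P (tr x).
case: (tr x) => a b; case: (tr (star x)) => c d.
rewrite !lecE /= => /andP[_ h1] /andP[/eqP h2 _] /andP[/eqP h3 _].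
nra.
Qed.

End Trace.

End Estimates.

Lemma lim_congr (T : pnbhsType) (F G : set_system T) :
  (forall l : T, F `=>` @nbhs T T l <-> G `=>` @nbhs T T l) -> lim F = lim G.
Proof.
move=> FG; have e : (fun l => F `=>` @nbhs T T l) = (fun l => G `=>` @nbhs T T l).
  by apply/funext => l; apply/propext; exact: FG.
exact: (f_equal (@xget T point) e).
Qed.

Record boundedSeq (R : realType) (M : nat -> tracialVNA R) := BoundedSeq {
  bseq_val :> forall i, M i;
  bseq_bounded : exists K : R, forall i, vnorm (bseq_val i) <= K }.

HB.instance Definition _ (R : realType) (M : nat -> tracialVNA R) :=
  gen_eqMixin (boundedSeq M).
HB.instance Definition _ (R : realType) (M : nat -> tracialVNA R) :=
  gen_choiceMixin (boundedSeq M).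

Section BoundedSeq.
Variables (R : realType) (M : nat -> tracialVNA R).
Implicit Types x y : boundedSeq M.

Lemma bseq_ext x y : (forall i, x i = y i) -> x = y.
Proof.
case: x y => x hx [y hy] /= xy; have {}xy : x = y by exact: functional_extensionality_dep.
by move: hx; rewrite xy => hx; congr BoundedSeq; exact: Prop_irrelevance.
Qed.

Fact bseq_zero_subproof : exists K : R, forall i, vnorm (0 : M i) <= K.
Proof. by exists 0 => i; exact: vnorm0. Qed.
Definition bseq_zero := BoundedSeq bseq_zero_subproof.

Fact bseq_one_subproof : exists K : R, forall i, vnorm (1 : M i) <= K.
Proof. by exists 1 => i; exact: vnorm1. Qed.
Definition bseq_one := BoundedSeq bseq_one_subproof.

Fact bseq_opp_subproof x : exists K : R, forall i, vnorm (- x i) <= K.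
Proof.
by have [K hK] := bseq_bounded x; exists K => i; apply: le_trans (vnormN _) _.
Qed.
Definition bseq_opp x := BoundedSeq (bseq_opp_subproof x).

Fact bseq_add_subproof x y : exists K : R, forall i, vnorm (x i + y i) <= K.
Proof.
have [K hK] := bseq_bounded x; have [L hL] := bseq_bounded y.
by exists (K + L) => i; apply: le_trans (vnormD _ _) _; rewrite lerD.
Qed.
Definition bseq_add x y := BoundedSeq (bseq_add_subproof x y).

Fact bseq_mul_subproof x y : exists K : R, forall i, vnorm (x i * y i) <= K.
Proof.
have [K hK] := bseq_bounded x; have [L hL] := bseq_bounded y.
exists (K * L) => i; apply: le_trans (vnormM _ _) _.
by rewrite ler_pM ?vnorm_ge0.
Qed.
Definition bseq_mul x y := BoundedSeq (bseq_mul_subproof x y).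

Fact bseq_scale_subproof (a : R[i]) x :
  exists K : R, forall i, vnorm (a *: x i) <= K.
Proof.
have [K hK] := bseq_bounded x.
exists (complex.Re `|a| * K) => i; apply: le_trans (vnormZ _ _) _.
by rewrite ler_wpM2l// -(@ler0c R) RRe_real ?normr_real ?normr_ge0.
Qed.
Definition bseq_scale a x := BoundedSeq (bseq_scale_subproof a x).

Fact bseq_star_subproof x : exists K : R, forall i, vnorm (star (x i)) <= K.
Proof.
have [K hK] := bseq_bounded x.
by exists K => i; apply: le_trans (vnorm_star _) _.
Qed.
Definition bseq_star x := BoundedSeq (bseq_star_subproof x).

End BoundedSeq.

Section Ultraproduct.
Variables (R : realType) (U : set_system nat).
Context {hU : UltraFilter U}.
Variable M : nat -> tracialVNA R.
Implicit Types x y z : boundedSeq M.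

Definition ultra_equiv x y := norm2 (x i - y i) @[i --> U] --> (0 : R).

Lemma ultra_equivP x y : ultra_equiv x y <->
  forall e : R, 0 < e -> \forall i \near U, sqnorm2 (x i - y i) <= e.
Proof.
split=> [/cvgr0Pnorm_lt h e e0|h].
  have se : 0 < Num.sqrt e by rewrite sqrtr_gt0.
  have := h _ se; apply: filterS => i /=.
  rewrite ger0_norm ?sqrtr_ge0// /norm2 ltr_sqrt//; exact: ltW.
apply/cvgr0Pnorm_le => e e0.
have se : 0 < e ^+ 2 by rewrite exprn_gt0.
have := h _ se; apply: filterS => i /= hi.
rewrite ger0_norm ?sqrtr_ge0// -[leRHS](ger0_norm (ltW e0)) -sqrtr_sqr /norm2.
by rewrite ler_wsqrtr.
Qed.

Lemma ultra_equiv_refl x : ultra_equiv x x.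
Proof.
apply/ultra_equivP => e e0; apply: nearW => i.
by rewrite subrr sqnorm2_0 ltW.
Qed.

Lemma ultra_equiv_sym x y : ultra_equiv x y -> ultra_equiv y x.
Proof.
move=> /ultra_equivP h; apply/ultra_equivP => e /h; apply: filterS => i.
by rewrite -opprB sqnorm2N.
Qed.

Lemma ultra_equiv_bound x y z w x' y' (K L : R) :
  ultra_equiv x y -> ultra_equiv z w ->
  (forall i, sqnorm2 (x' i - y' i) <=
    K * sqnorm2 (x i - y i) + L * sqnorm2 (z i - w i)) ->
  ultra_equiv x' y'.
Proof.
move=> /ultra_equivP hx /ultra_equivP hz hb; apply/ultra_equivP => e e0.
have d0 : 0 < e / (`|K| + `|L| + 1) by rewrite divr_gt0// ltr_wpDl// addr_ge0.
near=> i; apply: le_trans (hb i) _.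
have h1 : sqnorm2 (x i - y i) <= e / (`|K| + `|L| + 1) by near: i; exact: hx.
have h2 : sqnorm2 (z i - w i) <= e / (`|K| + `|L| + 1) by near: i; exact: hz.
move: h1 h2; set d := e / _ => h1 h2.
have dp : 0 <= d by rewrite ltW.
have -> : e = (`|K| + `|L| + 1) * d.
  by rewrite mulrC divfK// gt_eqF// ltr_wpDl// addr_ge0.
rewrite -addrA mulrDl; apply: lerD.
  apply: le_trans (ler_wpM2r (sqnorm2_ge0 _) (ler_norm K)) _.
  by rewrite ler_wpM2l.
apply: le_trans (ler_wpM2r (sqnorm2_ge0 _) (ler_norm L)) _.
by rewrite mulrDl mul1r ler_wpDr// ler_wpM2l.
Unshelve. all: by end_near.
Qed.

Lemma ultra_equiv_trans : forall y x z,
  ultra_equiv x y -> ultra_equiv y z -> ultra_equiv x z.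
Proof.
move=> y x z xy yz; apply: (ultra_equiv_bound (K := 2) (L := 2) xy yz) => i.
by rewrite -[x i - z i](subrKA (y i)); exact: sqnorm2D.
Qed.

Definition ultra_equivb x y := `[< ultra_equiv x y >].

Fact ultra_equivb_refl : reflexive ultra_equivb.
Proof. by move=> x; apply/asboolP; exact: ultra_equiv_refl. Qed.

Fact ultra_equivb_sym : symmetric ultra_equivb.
Proof.
by move=> x y; apply/asboolP/asboolP; exact: ultra_equiv_sym.
Qed.

Fact ultra_equivb_trans : transitive ultra_equivb.
Proof.
by move=> y x z /asboolP xy /asboolP yz; apply/asboolP; exact: ultra_equiv_trans yz.
Qed.

Canonical ultra_equiv_rel :=
  EquivRel ultra_equivb ultra_equivb_refl ultra_equivb_sym ultra_equivb_trans.

Definition ultraproduct := {eq_quot ultra_equiv_rel}.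

HB.instance Definition _ := Choice.on ultraproduct.
HB.instance Definition _ := Quotient.on ultraproduct.

Definition ultra_class x : ultraproduct := \pi_ultraproduct x.

Implicit Types X Y Z : ultraproduct.

Lemma ultra_classK X : ultra_class (repr X) = X.
Proof. exact: reprK. Qed.

Lemma ultra_classP x y : ultra_class x = ultra_class y <-> ultra_equiv x y.
Proof.
split=> [/eqmodP/asboolP //|h]; apply/eqmodP/asboolP; exact: h.
Qed.

Lemma repr_ultra_class x : ultra_equiv (repr (ultra_class x)) x.
Proof. by apply/ultra_classP; rewrite ultra_classK. Qed.

Definition ultra_zero := ultra_class (bseq_zero M).
Definition ultra_one := ultra_class (bseq_one M).
Definition ultra_opp X := ultra_class (bseq_opp (repr X)).
Definition ultra_add X Y := ultra_class (bseq_add (repr X) (repr Y)).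
Definition ultra_mul X Y := ultra_class (bseq_mul (repr X) (repr Y)).
Definition ultra_scale (a : R[i]) X := ultra_class (bseq_scale a (repr X)).
Definition ultra_star X := ultra_class (bseq_star (repr X)).

(* The limit exists, the traces being bounded; by [ultra_trE] below it does not
   depend on the representative. *)
Definition ultra_tr X : R[i] :=
  lim ((tr (repr X i) : R[i]^o) @[i --> U]).

Lemma ultra_oppE x : ultra_opp (ultra_class x) = ultra_class (bseq_opp x).
Proof.
have h := repr_ultra_class x.
apply/ultra_classP/(ultra_equiv_bound (K := 1) (L := 0) h h) => i /=.
by rewrite -opprD sqnorm2N mul0r mul1r addr0.
Qed.

Lemma ultra_addE x y :
  ultra_add (ultra_class x) (ultra_class y) = ultra_class (bseq_add x y).
Proof.
have hx := repr_ultra_class x; have hy := repr_ultra_class y.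
apply/ultra_classP/(ultra_equiv_bound (K := 2) (L := 2) hx hy) => i /=.
by rewrite opprD addrACA; exact: sqnorm2D.
Qed.

Lemma ultra_mulE x y :
  ultra_mul (ultra_class x) (ultra_class y) = ultra_class (bseq_mul x y).
Proof.
have hx := repr_ultra_class x; have hy := repr_ultra_class y.
set x' := repr _ in hx *; set y' := repr _ in hy *.
have [K hK] := bseq_bounded y'; have [L hL] := bseq_bounded x.
apply/ultra_classP.
apply/(ultra_equiv_bound (K := 2 * K ^+ 2) (L := 2 * L ^+ 2) hx hy) => i /=.
have -> : x' i * y' i - x i * y i = (x' i - x i) * y' i + x i * (y' i - y i).
  by rewrite mulrBl mulrBr addrA subrK.
apply: le_trans (sqnorm2D _ _) _.
rewrite -(mulrA 2 (K ^+ 2)) -(mulrA 2 (L ^+ 2)).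
have sq (a b : R) : 0 <= a -> a <= b -> a ^+ 2 <= b ^+ 2.
  by move=> a0 ab; rewrite ler_sqr ?nnegrE// (le_trans a0).
rewrite lerD// ler_wpM2l//.
  apply: le_trans (sqnorm2Mr _ _) _.
  by rewrite ler_wpM2r ?sqnorm2_ge0// sq ?vnorm_ge0.
apply: le_trans (sqnorm2Ml _ _) _.
by rewrite ler_wpM2r ?sqnorm2_ge0// sq ?vnorm_ge0.
Qed.

Lemma ultra_scaleE a x :
  ultra_scale a (ultra_class x) = ultra_class (bseq_scale a x).
Proof.
have h := repr_ultra_class x.
apply/ultra_classP.
apply/(ultra_equiv_bound (K := complex.Re `|a| ^+ 2) (L := 0) h h) => i /=.
by rewrite -scalerBr sqnorm2Z mul0r addr0.
Qed.

Lemma ultra_starE x : ultra_star (ultra_class x) = ultra_class (bseq_star x).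
Proof.
have h := repr_ultra_class x.
apply/ultra_classP/(ultra_equiv_bound (K := 1) (L := 0) h h) => i /=.
by rewrite -starN -starD sqnorm2_star mul0r mul1r addr0.
Qed.

Lemma ultra_trE x :
  ultra_tr (ultra_class x) = lim ((tr (x i) : R[i]^o) @[i --> U]).
Proof.
have /ultra_equivP h := repr_ultra_class x.
rewrite /ultra_tr; set x' := repr _ in h *.
have d0 : (tr (x' i) - tr (x i) : R[i]^o) @[i --> U] --> (0 : R[i]^o).
  apply/cvgr0Pnorm_le => e e0.
  have /eqP eE : e == (complex.Re e)%:C by rewrite RRe_real// gtr0_real.
  have re0 : 0 < complex.Re e by rewrite -ltcR -eE.
  have := h _ (exprn_gt0 2 re0); apply: filterS => i hi.
  have := le_trans (tr_le_sqnorm2 _) hi.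
  have n0 : 0 <= complex.Re `|tr (x' i - x i)|.
    by rewrite -(@ler0c R) RRe_real ?normr_real ?normr_ge0.
  rewrite ler_sqr ?nnegrE ?(ltW re0)// -lecR -eE RRe_real ?normr_real//.
  by rewrite linearB.
have ab l : (tr (x' i) : R[i]^o) @[i --> U] --> (l : R[i]^o) <->
            (tr (x i) : R[i]^o) @[i --> U] --> (l : R[i]^o).
  split=> hl.
    have -> : (fun i => tr (x i) : R[i]^o) =
        (fun i => tr (x' i) - (tr (x' i) - tr (x i))).
      by apply/funext => i; rewrite subKr.
    by rewrite -[l : R[i]^o]subr0; exact: cvgB hl d0.
  have -> : (fun i => tr (x' i) : R[i]^o) =
      (fun i => tr (x i) + (tr (x' i) - tr (x i))).
    by apply/funext => i; rewrite addrC subrK.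
  by rewrite -[l : R[i]^o]addr0; exact: cvgD hl d0.
exact: lim_congr ab.
Qed.

Let ind (P : ultraproduct -> Prop) :
  (forall x, P (ultra_class x)) -> forall X, P X.
Proof. by move=> h X; rewrite -(ultra_classK X). Qed.

Local Ltac ultra := do ?[elim/ind => ?];
  rewrite /ultra_zero /ultra_one
          ?(ultra_addE, ultra_oppE, ultra_mulE, ultra_scaleE);
  congr ultra_class; apply: bseq_ext => i /=.

Fact ultra_addA : associative ultra_add.
Proof. by ultra; rewrite addrA. Qed.
Fact ultra_addC : commutative ultra_add.
Proof. by ultra; rewrite addrC. Qed.
Fact ultra_add0 : left_id ultra_zero ultra_add.
Proof. by ultra; rewrite add0r. Qed.
Fact ultra_addN : left_inverse ultra_zero ultra_opp ultra_add.
Proof. by ultra; rewrite addNr. Qed.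

HB.instance Definition _ := GRing.isZmodule.Build ultraproduct
  ultra_addA ultra_addC ultra_add0 ultra_addN.

Fact ultra_mulA : associative ultra_mul.
Proof. by ultra; rewrite mulrA. Qed.
Fact ultra_mul1l : left_id ultra_one ultra_mul.
Proof. by ultra; rewrite mul1r. Qed.
Fact ultra_mul1r : right_id ultra_one ultra_mul.
Proof. by ultra; rewrite mulr1. Qed.
Fact ultra_mulDl : left_distributive ultra_mul ultra_add.
Proof. by ultra; rewrite mulrDl. Qed.
Fact ultra_mulDr : right_distributive ultra_mul ultra_add.
Proof. by ultra; rewrite mulrDr. Qed.
Fact ultra_one_neq0 : ultra_one != ultra_zero.
Proof.
apply/eqP => /ultra_classP/ultra_equivP h.
have h2 : 0 < (2^-1 : R) by rewrite invr_gt0.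
have [i /=] := filter_ex (h _ h2); rewrite subr0 sqnorm2_1; lra.
Qed.

HB.instance Definition _ := GRing.Zmodule_isNzRing.Build ultraproduct
  ultra_mulA ultra_mul1l ultra_mul1r ultra_mulDl ultra_mulDr ultra_one_neq0.

Fact ultra_scaleA a b X :
  ultra_scale a (ultra_scale b X) = ultra_scale (a * b) X.
Proof. by elim/ind: X => x; ultra; rewrite scalerA. Qed.
Fact ultra_scale1 : left_id 1 ultra_scale.
Proof. by ultra; rewrite scale1r. Qed.
Fact ultra_scaleDr : right_distributive ultra_scale +%R.
Proof.
by move=> a; elim/ind => x; elim/ind => y;
   rewrite /GRing.add /=; ultra; rewrite scalerDr.
Qed.
Fact ultra_scaleDl X : {morph ultra_scale^~ X : a b / a + b}.
Proof.
by elim/ind: X => x a b; rewrite /GRing.add /=; ultra; rewrite scalerDl.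
Qed.

HB.instance Definition _ := GRing.Zmodule_isLmodule.Build R[i] ultraproduct
  ultra_scaleA ultra_scale1 ultra_scaleDr ultra_scaleDl.

Fact ultra_scaleAl (a : R[i]) X Y : a *: (X * Y) = a *: X * Y.
Proof.
elim/ind: X => x; elim/ind: Y => y; rewrite /GRing.mul /GRing.scale /=.
by ultra; rewrite scalerAl.
Qed.
HB.instance Definition _ :=
  GRing.Lmodule_isLalgebra.Build R[i] ultraproduct ultra_scaleAl.

Fact ultra_scaleAr (a : R[i]) X Y : a *: (X * Y) = X * (a *: Y).
Proof.
elim/ind: X => x; elim/ind: Y => y; rewrite /GRing.mul /GRing.scale /=.
by ultra; rewrite scalerAr.
Qed.
HB.instance Definition _ :=
  GRing.Lalgebra_isAlgebra.Build R[i] ultraproduct ultra_scaleAr.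

End Ultraproduct.

Arguments ultraproduct {R} U {hU} M.
Arguments ultra_class {R} U {hU M} x.
Arguments ultra_star {R U hU M} X.
Arguments ultra_tr {R U hU M} X.

Section Lifting.
Variables (R : realType) (U : set_system nat).
Context {hU : UltraFilter U}.
Variable M : nat -> tracialVNA R.

(* Multiplicativity and linearity are part of the type of [alpha]. *)
Definition trace_preserving_automorphism
    (alpha : {lrmorphism ultraproduct U M -> ultraproduct U M}) :=
  [/\ bijective alpha,
      forall X, alpha (ultra_star X) = ultra_star (alpha X) &
      forall X, ultra_tr (alpha X) = ultra_tr X].

Definition lifts_to (alpha : ultraproduct U M -> ultraproduct U M)
    (phi : forall i, M i -> M i) :=
  forall x : boundedSeq M, exists2 y : boundedSeq M,
    forall i, y i = phi i (x i) & alpha (ultra_class U x) = ultra_class U y.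

End Lifting.

(* Main.v *)
Require Import Defs.
From HB Require Import structures.
From mathcomp Require Import all_boot all_order all_algebra.
From mathcomp Require Import complex.
From mathcomp Require Import all_classical all_reals all_analysis.
From mathcomp Require Import ring lra.

(* Let [f = tr \o phi i]. Zorn's lemma, applied to the positive contractions [q]
   ordered so that both [q] and [f q - i * tr q] increase, gives a [q] with
   [i * tr q <= f q] and [f y <= i * tr y] whenever [0 <= y <= 1 - q]; chains
   have suprema by Vigier's theorem. Then [tr q <= f 1 / i] tends to [0], so
   [b = 1 - q] represents [1] in the ultraproduct and
   [psi i x = phi i (b * x * b)] still lifts [alpha]. Since [b * b <= b],
   [tr (psi i x) <= i * tr (b * x * b)] for [x >= 0]; as [tr] is faithful and
   normal, this domination makes [psi i] normal. *)

Set Implicit Arguments.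
Unset Strict Implicit.
Unset Printing Implicit Defensive.

Import Order.TTheory GRing.Theory Num.Theory.
Import numFieldNormedType.Exports.
Local Open Scope classical_set_scope.
Local Open Scope ring_scope.
Local Open Scope complex_scope.

(** * Positive operators and the operator order *)

Section Positive.
Variables (R : realType) (M : vnAlgebra R).
Implicit Types (x y c : M).

Lemma vpos0 : vpos (0 : M).
Proof. by move=> v; rewrite vn_op0l inner0l. Qed.

Lemma vposD x y : vpos x -> vpos y -> vpos (x + y).
Proof. by move=> hx hy v; rewrite vn_opDl innerDl addr_ge0 ?hx ?hy. Qed.

Lemma vposZ (a : R) x : 0 <= a -> vpos x -> vpos (a%:C *: x).
Proof. by move=> a0 hx v; rewrite vn_opZl innerZl mulr_ge0 ?hx// ler0c. Qed.

Lemma vpos1 : vpos (1 : M).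
Proof. by rewrite -[1]mulr1 -{1}star1; exact: vpos_star_mul. Qed.

Lemma vpos_conj x y : vpos x -> vpos (star y * x * y).
Proof. by move=> hx v; rewrite -mulrA !vn_op_mul star_adjointC; exact: hx. Qed.

Lemma vle_refl x : vle x x.
Proof. by rewrite /vle subrr; exact: vpos0. Qed.

Lemma vle_trans x y z : vle x y -> vle y z -> vle x z.
Proof. by move=> xy yz; rewrite /vle -(subrK y z) -addrA; exact: vposD. Qed.

(** Polarization: the form of [x] is real at [v], [w], [v + w] and [v + 'i *: w], and comparing
    imaginary parts shows that it is hermitian. *)
Lemma vpos_star x : vpos x -> star x = x.
Proof.
move=> hx; apply: vn_ext => v w; rewrite star_adjointC.
have P a : 0 <= inner _ (vn_op x (v + a *: w)) (v + a *: w) := hx _.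
have [lin _] := vn_op_bounded x.
move: (P 1) (P 'i) (hx v) (hx w).
rewrite ![v + _ *: w]addrC !lin !innerDl !innerDr !innerZl !innerZr.
rewrite (innerC v (vn_op x w)).
case: (inner _ (vn_op x v) v) => a a'; case: (inner _ (vn_op x w) w) => b b'.
case: (inner _ (vn_op x w) v) => d d'; case: (inner _ (vn_op x v) w) => c c'.
rewrite !lecE /= => /andP[/eqP h1 _] /andP[/eqP h2 _] /andP[/eqP h3 _].
move=> /andP[/eqP h4 _].
apply/eqP; rewrite eq_complex /=; apply/andP; split; apply/eqP; lra.
Qed.

Lemma vpos_re_ge0 x : star x = x ->
  (forall v, 0 <= complex.Re (inner _ (vn_op x v) v)) -> vpos x.
Proof.
move=> sx hx v; have := star_adjointC x v v; rewrite sx [X in _ = X -> _]innerC.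
move: (hx v); case: (inner _ (vn_op x v) v) => a b /= a0 [e].
by rewrite lecE /= a0 andbT; apply/eqP; lra.
Qed.

Lemma vpos_scalar_sub (N : R) x : star x = x -> vnorm x <= N ->
  vpos (N%:C *: 1 - x).
Proof.
move=> sx xN; apply: vpos_re_ge0 => [|v].
  by rewrite starD starN starZ star1 sx; congr (_ *: _ - _); exact: conjc_real.
rewrite vn_opDl vn_opNl vn_opZl vn_op_one innerDl innerNl innerZl inner_rnorm.
rewrite -rmorphM raddfD raddfN /= subr_ge0.
apply: le_trans (re_inner_le _ _) _; rewrite expr2 mulrA ler_wpM2r ?rnorm_ge0//.
by apply: le_trans (vnorm_le _ _) _; rewrite ler_wpM2r ?rnorm_ge0.
Qed.

(** With [d = N - c], which commutes with [c], the sum of the two positive conjugates [c * d * c]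
    and [d * c * d] is [N *: (c * d)], and [c * d] is the element in question. This avoids square
    roots. *)
Lemma vpos_sqr_bound (N : R) c : 0 < N -> vpos c -> vpos (N%:C *: 1 - c) ->
  vpos (N%:C *: c - c * c).
Proof.
move=> N0 hc hNc; set d := N%:C *: 1 - c in hNc.
have sd := vpos_star hNc; have sc := vpos_star hc.
have h : vpos (c * d * c + d * c * d).
  by apply: vposD; [rewrite -{1}sc|rewrite -{1}sd]; exact: vpos_conj.
have -> : N%:C *: c - c * c = (N^-1)%:C *: (c * d * c + d * c * d).
  have -> : c * d * c = c * c * d.
    by rewrite /d !mulrBr !mulrBl -!scalerAr -!scalerAl !mulr1 ?mulrA.
  have -> : d * c * d = N%:C *: (c * d) - c * c * d.
    by rewrite {1}/d mulrBl mulrBl -!scalerAl mul1r.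
  rewrite [X in _ = _ *: X]addrC subrK scalerA -rmorphM /= mulVf ?gt_eqF//.
  by rewrite scale1r /d mulrBr -scalerAr mulr1.
by apply: vposZ => //; rewrite invr_ge0 ltW.
Qed.

Lemma vpos_rnorm_bound (N : R) c v : 0 < N -> vpos c -> vpos (N%:C *: 1 - c) ->
  rnorm (vn_op c v) ^+ 2 <= N * complex.Re (inner _ (vn_op c v) v).
Proof.
move=> N0 hc hNc; have := vpos_sqr_bound N0 hc hNc v.
rewrite vn_opDl vn_opNl vn_opZl innerDl innerNl innerZl vn_op_mul.
rewrite -{2}(vpos_star hc) star_adjointC inner_rnorm.
have := hc v; case: (inner _ (vn_op c v) v) => a b.
by rewrite !lecE /= => /andP[/eqP -> _] /andP[_]; rewrite mulr0 subr0 subr_ge0.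
Qed.

(** For [c = y - x] both [c] and [1 - c] are positive, so the squared norm of [c v] is at most the
    form of [c] at [v], which is at most [0]. *)
Lemma vle_anti x y : vle x y -> vle y x -> x = y.
Proof.
rewrite /vle -(opprB y x) => h1 h2.
apply/esym/eqP; rewrite -subr_eq0; apply/eqP.
move: (y - x) h1 h2 => c hc hNc; apply: (@vn_op_inj R M); apply/funext => v.
rewrite vn_op0l; apply/rnorm_eq0/eqP; rewrite -sqrf_eq0; apply/eqP/le_anti.
rewrite sqr_ge0 andbT.
have h : vpos (1%:C *: 1 - c) by rewrite scale1r; exact: vposD vpos1 hNc.
apply: le_trans (vpos_rnorm_bound v ltr01 hc h) _; rewrite mul1r.
by have := hNc v; rewrite vn_opNl innerNl oppr_ge0 lecE /= => /andP[].
Qed.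

(** Cauchy-Schwarz on the right side of [vpos_rnorm_bound] leaves a factor [rnorm (vn_op c v)] to
    cancel. *)
Lemma vpos_rnorm_le (N : R) c v : 0 < N -> vpos c -> vpos (N%:C *: 1 - c) ->
  rnorm (vn_op c v) <= N * rnorm v.
Proof.
move=> N0 hc hNc; have := vpos_rnorm_bound v N0 hc hNc.
have := re_inner_le (vn_op c v) v; have := rnorm_ge0 (vn_op c v).
set a := rnorm (vn_op c v); set b := rnorm v; set r := complex.Re _.
rewrite le_eqVlt => /predU1P[<- _ _|a0 h1 h2].
  by rewrite mulr_ge0 ?rnorm_ge0// ltW.
rewrite -(ler_pM2l a0) -expr2; apply: le_trans h2 _.
by rewrite mulrCA ler_pM2l.
Qed.

End Positive.

(** * Complex moduli and limits of nonnegative numbers *)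

Lemma Re_norm_sq (R : realType) (z : R[i]) :
  complex.Re `|z| ^+ 2 = complex.Re z ^+ 2 + complex.Im z ^+ 2.
Proof.
apply: (@complexI R); transitivity ((complex.Re `|z|)%:C ^+ 2).
  exact: rmorphXn.
by rewrite RRe_real ?normr_real// add_Re2_Im2.
Qed.

Lemma Re_norm_ge0 (R : realType) (z : R[i]) : 0 <= complex.Re `|z|.
Proof. by rewrite -(@ler0c R) RRe_real ?normr_real ?normr_ge0. Qed.

Lemma norm_inner_le (R : realType) (H : hilbertType R) (v w : H) :
  complex.Re `|inner H v w| <= rnorm v * rnorm w.
Proof.
set z := inner H v w.
have [->|z0] := eqVneq (complex.Re `|z|) 0.
  by rewrite mulr_ge0 ?rnorm_ge0.
have zp : 0 < complex.Re `|z| by rewrite lt_neqAle eq_sym z0 Re_norm_ge0.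
rewrite -(ler_pM2l zp) -expr2.
(* Scaling [v] by the conjugate of [z] makes the inner product real, equal to the square of the
   modulus of [z], so the bound on real parts suffices. *)
have := re_inner_le (z^* *: v) w; rewrite innerZl -/z rnormZ norm_conjC -mulrA.
suff -> : z^* * z = (complex.Re `|z| ^+ 2)%:C by [].
rewrite mulrC -normCK -[in LHS](RRe_real (normr_real z)).
symmetry; exact: rmorphXn.
Qed.

Lemma Re_le_norm (R : realType) (z : R[i]) : complex.Re z <= complex.Re `|z|.
Proof. by have := Re_norm_sq z; have := Re_norm_ge0 z; nra. Qed.

(** The nonnegative half-line is closed in the complex plane. This is how positivity passes to weak
    limits below. *)
Lemma near_ge0 (R : realType) (z : R[i]) :
  (forall e : R, 0 < e -> exists p, 0 <= p /\ complex.Re `|z - p| <= e) ->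
  0 <= z.
Proof.
move=> h.
have {}h (e : R) : 0 < e -> - e <= complex.Re z /\ `|complex.Im z| <= e.
  move=> e0; have [[p p'] [p0 hz]] := h _ e0.
  have := Re_norm_sq (z - (p +i* p')); have := Re_norm_ge0 (z - (p +i* p')).
  move: (complex.Re `|_|) hz p0 => n ne; rewrite lecE.
  case: z {h} => a b /= /andP[/eqP -> p0] n0 hn.
  split; first by nra.
  have he : b ^+ 2 <= e ^+ 2.
    apply: (@le_trans _ _ (n ^+ 2)); last by rewrite ler_sqr ?nnegrE ?(ltW e0).
    by rewrite hn subr0 lerDr sqr_ge0.
  by rewrite -ler_sqr ?nnegrE ?(ltW e0)// real_normK ?num_real.
rewrite lecE; apply/andP; split.
  rewrite -normr_eq0; apply/eqP/le_anti; rewrite normr_ge0 andbT.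
  by apply/ler_addgt0Pr => e /h[_]; rewrite add0r.
by apply/ler_addgt0Pr => e /h[he _]; rewrite -lerBlDr sub0r.
Qed.

(** * Vigier's theorem: bounded directed sets have suprema, which are limits *)

Section Vigier.
Variables (R : realType) (M : vnAlgebra R) (D : set M) (u : M).
Hypotheses (hD : updirected (@vle R M) D) (hu : forall d, D d -> vle d u).

(** The tails generate the section filter of [D], so limits along [F] are limits of the increasing
    net. *)
Let tail (d : M) := [set x | D x /\ vle d x].
Let F := filter_from D tail.

Local Instance F_proper : ProperFilter F.
Proof.
apply: filter_from_proper => [|d Dd]; last first.
  by exists d; split=> //; exact: vle_refl.
apply: filter_from_filter; first exact: hD.1.
move=> a b Da Db; have [c [Dc ac bc]] := hD.2 _ _ Da Db.
exists c => // x [Dx cx]; split; split=> //; exact: vle_trans cx.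
Qed.

Let re_le (d d' : M) v : vle d d' ->
  complex.Re (inner _ (vn_op d v) v) <= complex.Re (inner _ (vn_op d' v) v).
Proof.
move=> /(_ v); rewrite vn_opDl vn_opNl innerDl innerNl.
by rewrite subr_ge0 lecE => /andP[].
Qed.

(** Here [0 <= d' - d <= u - d0 <= N], so a single constant serves all pairs above [d0]. *)
Let rnorm_bound (d0 d d' : M) (N := vnorm (u - d0) + 1) v :
  D d' -> vle d0 d -> vle d d' ->
  rnorm (vn_op d' v - vn_op d v) ^+ 2 <=
    N * (complex.Re (inner _ (vn_op d' v) v) -
         complex.Re (inner _ (vn_op d v) v))
  /\ rnorm (vn_op d' v - vn_op d v) <= N * rnorm v.
Proof.
move=> Dd' d0d dd'.
have N0 : 0 < N by rewrite ltr_wpDl ?vnorm_ge0.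
have d0u : vle d0 u by apply: vle_trans (hu Dd'); exact: vle_trans dd'.
have h : vpos (N%:C *: 1 - (d' - d)).
  have -> : N%:C *: 1 - (d' - d) =
      (N%:C *: 1 - (u - d0)) + ((u - d') + (d - d0)) :> M.
    rewrite -addrA; congr (_ + _).
    by rewrite !opprB addrA subrKA [RHS]addrC subrKA.
  apply: vposD; last by apply: vposD => //; exact: hu.
  by apply: vpos_scalar_sub; [exact: vpos_star | rewrite lerDl].
rewrite -vn_opNl -vn_opDl; split; last exact: vpos_rnorm_le.
apply: le_trans (vpos_rnorm_bound v N0 dd' h) _.
by rewrite vn_opDl vn_opNl innerDl innerNl raddfD raddfN.
Qed.

Let cauchy_orbit v : cvg (vn_op d v @[d --> F]).
Proof.
have [d0 Dd0] := hD.1; pose N := vnorm (u - d0) + 1.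
have N0 : 0 < N by rewrite ltr_wpDl ?vnorm_ge0.
pose S := [set complex.Re (inner _ (vn_op d v) v) | d in D].
have S_sup : has_sup S.
  split; first by exists (complex.Re (inner _ (vn_op d0 v) v)), d0.
  by exists (complex.Re (inner _ (vn_op u v) v)) => _ [d Dd <-]; apply/re_le/hu.
apply: cauchy_cvg; apply: cauchy_exP => e e0.
have e_re : e = (complex.Re e)%:C by rewrite RRe_real// gtr0_real.
have re0 : 0 < complex.Re e by rewrite -ltcR -e_re.
(* The forms at [v] increase and are bounded by that of [u]. Beyond an element within [e ^+ 2 / N]
   of their supremum, [rnorm_bound] keeps the vectors within [e]; going above [d0] as well makes [N]
   valid. *)
have [|_ [d2 Dd2 <-] hd2] :=
  sup_adherent _ S_sup (eps := complex.Re e ^+ 2 / N).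
  by rewrite divr_gt0 ?exprn_gt0.
have [d1 [Dd1 d01 d21]] := hD.2 _ _ Dd0 Dd2.
exists (vn_op d1 v), d1 => // d [Dd d1d] /=.
rewrite -ball_normE /= distrC rnormE e_re ltcR.
have [h _] := rnorm_bound v Dd d01 d1d.
have := sup_upper_bound S_sup; move=> /(_ _ (imageP _ Dd)) /= hd.
have h1 := re_le v d21.
rewrite -(ltr_pXn2r (n := 2)) ?nnegrE ?rnorm_ge0 ?(ltW re0)//.
apply: le_lt_trans h _; rewrite -/N mulrC -ltr_pdivlMr//; lra.
Qed.

Let T v := lim (vn_op d v @[d --> F]).

Let T_lin (a : R[i]) v w : T (a *: v + w) = a *: T v + T w.
Proof.
apply: cvg_lim; first exact: norm_hausdorff.
have -> : (fun d => vn_op d (a *: v + w)) =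
    (fun d => a *: vn_op d v + vn_op d w).
  by apply/funext => d; have [lin _] := vn_op_bounded d; exact: lin.
by apply: cvgD; [apply: cvgZr|]; exact: cauchy_orbit.
Qed.

Let T_near v (e : R) : 0 < e -> \forall d \near F, rnorm (T v - vn_op d v) < e.
Proof.
move=> e0; have e0' : 0 < e%:C by rewrite ltcR.
have hv : vn_op d v @[d --> F] --> T v by exact: cauchy_orbit.
have : \forall d \near F, `|T v - vn_op d v| < e%:C.
  by exact: cvgr_dist_lt hv _ e0'.
apply: filterS => d /=.
by rewrite rnormE ltcR.
Qed.

Let T_bounded : bounded_operator T.
Proof.
split; first exact: T_lin.
have [d0 Dd0] := hD.1; pose N := vnorm (u - d0) + 1.
exists (N + vnorm d0) => v; apply/ler_addgt0Pr => e e0.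
have [d1 Dd1 /= hd1] := T_near v e0.
have [d [Dd d0d d1d]] := hD.2 _ _ Dd0 Dd1.
have h1 := hd1 d (conj Dd d1d).
have d00 : vle d0 d0 by exact: vle_refl.
have [_ h2] := rnorm_bound v Dd d00 d0d.
have -> : T v = (T v - vn_op d v) + ((vn_op d v - vn_op d0 v) + vn_op d0 v).
  by rewrite !subrK.
apply: le_trans (rnormD _ _) _; rewrite addrC; apply: lerD; last exact: ltW.
apply: le_trans (rnormD _ _) _; rewrite mulrDl; apply: lerD => //.
exact: vnorm_le.
Qed.

(** Strong convergence implies weak convergence by Cauchy-Schwarz, and finitely many conditions hold
    together because [F] is a filter. *)
Let T_wot : wot_closure (range (@vn_op R M)) T.
Proof.
move=> s e e0.
have [d Dd hd] : exists2 d, D d & forall p, p \in s ->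
   `|inner _ (T p.1 - vn_op d p.1) p.2| < e%:C.
  suff : \forall d \near F, forall p, p \in s ->
      `|inner _ (T p.1 - vn_op d p.1) p.2| < e%:C.
    case=> d Dd h; exists d => //.
    by apply: h; split=> //; exact: vle_refl.
  elim: s => [|p s IH]; first exact: nearW.
  have h : 0 < e / (rnorm p.2 + 1) by rewrite divr_gt0// ltr_wpDl ?rnorm_ge0.
  apply: filterS2 IH (T_near p.1 h) => d hs hp q.
  rewrite inE => /predU1P[->|]; last exact: hs.
  rewrite -[X in X < _]RRe_real ?normr_real// ltcR.
  apply: le_lt_trans (norm_inner_le _ _) _.
  apply: (@le_lt_trans _ _ (rnorm (T p.1 - vn_op d p.1) * (rnorm p.2 + 1))).
    by rewrite ler_wpM2l ?rnorm_ge0// lerDl.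
  by rewrite -ltr_pdivlMr// ltr_wpDl ?rnorm_ge0.
by exists (vn_op d); [exists d|].
Qed.

(** The strong limit [T] belongs to the algebra by weak closedness, and order relations survive the
    limit. The second clause records convergence of the forms, which the order property alone does
    not display. *)
Lemma vigier : exists2 t, is_supremum (@vle R M) D t &
  forall v (e : R), 0 < e -> exists2 d, D d &
    complex.Re (inner _ (vn_op (t - d) v) v) <= e.
Proof.
have [t _ tT] := vna_closed (vn_op_range M) T_bounded T_wot.
have tE v (e : R) : 0 < e -> exists2 d1, D d1 & forall d, D d -> vle d1 d ->
    complex.Re `|inner _ (vn_op (t - d) v) v| <= e.
  move=> e0.
  have h : 0 < e / (rnorm v + 1) by rewrite divr_gt0// ltr_wpDl ?rnorm_ge0.
  have [d1 Dd1 hd1] := T_near v h; exists d1 => // d Dd d1d.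
  have {}hd1 := hd1 d (conj Dd d1d).
  apply: le_trans (norm_inner_le _ _) _; rewrite vn_opDl vn_opNl tT.
  rewrite -[leRHS](divfK (_ : rnorm v + 1 != 0)) ?gt_eqF ?ltr_wpDl ?rnorm_ge0//.
  by rewrite ler_pM ?rnorm_ge0 ?lerDl// ltW.
exists t; last first.
  move=> v e /(tE v)[d Dd hd]; exists d => //.
  apply: le_trans (hd d Dd _); first exact: Re_le_norm.
  by exact: vle_refl.
split=> [d Dd|u' hu'] v; apply: near_ge0 => e /(tE v)[d1 Dd1 hd1].
  have [d2 [Dd2 dd2 d12]] := hD.2 _ _ Dd Dd1.
  exists (inner _ (vn_op (d2 - d) v) v); split; first exact: dd2.
  (* With [d2] above both [d] and [d1], the first summand has a small form at [v] and the second is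
     positive. *)
  have -> : t - d = (t - d2) + (d2 - d) by rewrite addrA subrK.
  by rewrite vn_opDl innerDl addrK; exact: hd1.
exists (inner _ (vn_op (u' - d1) v) v); split; first exact: hu'.
have -> : u' - t = (u' - d1) - (t - d1) by rewrite opprB addrA subrK.
rewrite [vn_op (_ - (t - d1)) v]vn_opDl innerDl addrAC subrr add0r.
rewrite vn_opNl innerNl normrN.
by apply: hd1 => //; exact: vle_refl.
Qed.

End Vigier.

(** * Directed suprema under monotone maps and conjugation *)

Lemma updirected_image (R : realType) (M N : vnAlgebra R) (f : M -> N)
    (D : set M) : {homo f : x y / vle x y} ->
  updirected (@vle R M) D -> updirected (@vle R N) (f @` D).
Proof.
move=> hf [[d Dd] hD]; split; first by exists (f d), d.
move=> _ _ [x Dx <-] [y Dy <-]; have [z [Dz xz yz]] := hD _ _ Dx Dy.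
by exists (f z); split; [exists z | exact: hf | exact: hf].
Qed.

Section Sup.
Variables (R : realType) (M : vnAlgebra R).
Implicit Types (D : set M) (s x y : M).

(** Suprema are unique by antisymmetry, so any supremum inherits the convergence of the one built by
    [vigier]. *)
Lemma sup_near D s v (e : R) : updirected (@vle R M) D ->
  is_supremum (@vle R M) D s -> 0 < e ->
  exists2 d, D d & complex.Re (inner _ (vn_op (s - d) v) v) <= e.
Proof.
move=> hD [s_ub s_le] e0; have [t [t_ub t_le] ht] := vigier hD s_ub.
have -> : s = t by apply: vle_anti; [exact: s_le | exact: t_le].
exact: ht.
Qed.

Lemma conj_vle y : {homo (fun x => star y * x * y) : x x' / vle x x'}.
Proof. by move=> x x' xx'; rewrite /vle -mulrBl -mulrBr; exact: vpos_conj. Qed.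

(** The form of [star y * (s - d) * y] at [v] is that of [s - d] at [vn_op y v], which can be made
    arbitrarily small. *)
Lemma conj_sup y D s : updirected (@vle R M) D -> is_supremum (@vle R M) D s ->
  is_supremum (@vle R M) ((fun x => star y * x * y) @` D) (star y * s * y).
Proof.
move=> hD hs; split=> [_ [d Dd <-]|u hu v]; first exact/conj_vle/hs.1.
apply: near_ge0 => e e0; have [d Dd hd] := sup_near (vn_op y v) hD hs e0.
exists (inner _ (vn_op (u - star y * d * y) v) v); split.
  by apply: hu; exists d.
have -> : u - star y * s * y = (u - star y * d * y) - (star y * (s - d) * y).
  by rewrite mulrBr mulrBl opprB addrA subrK.
rewrite [vn_op (_ - _ * y) v]vn_opDl innerDl addrAC subrr add0r vn_opNl innerNl.
rewrite normrN -mulrA !vn_op_mul star_adjointC ger0_norm//; exact: hs.1.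
Qed.

End Sup.

(** * Normality of the trace and the Zorn argument *)

Lemma re_functional_le (R : realType) (M : tracialVNA R) (f : {scalar M})
    (f_ge0 : forall x, vpos x -> 0 <= f x) (x y : M) :
  vle x y -> complex.Re (f x) <= complex.Re (f y).
Proof.
move=> /f_ge0; rewrite linearB lecE /= => /andP[_].
by case: (f x) => ? ?; case: (f y) => ? ? /=; rewrite subr_ge0.
Qed.

Section Trace.
Variables (R : realType) (M : tracialVNA R).
Implicit Types (D : set M) (s x y : M).

(** Otherwise [tr s - e] would bound all traces over [D], although normality makes [tr s] their
    least bound. *)
Lemma tr_sup_near D s (e : R) : D `<=` [set x | star x = x] ->
  updirected (@vle R M) D -> is_supremum (@vle R M) D s -> 0 < e ->
  exists2 d, D d & complex.Re (tr (s - d)) < e.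
Proof.
move=> Dstar hD hs e0; have [_ s_le] := tr_normal Dstar hD hs.
apply: contrapT => hn.
have : tr s <= tr s - e%:C.
  apply: s_le => _ [d Dd <-]; rewrite -subr_ge0 addrAC -linearB /=.
  have /tr_ge0 := hs.1 d Dd.
  have : e <= complex.Re (tr (s - d)).
    by rewrite leNgt; apply/negP => h; apply: hn; exists d.
  case: (tr (s - d)) => a b /= ea; rewrite !lecE /= => /andP[/eqP -> _].
  by rewrite subr0 eqxx subr_ge0.
by rewrite -subr_ge0 addrAC subrr add0r oppr_ge0 lecR leNgt e0.
Qed.

(* [f] need not be normal: the bound [f q - C tr q] passes to the supremum of a
   chain because [f] is monotone and [tr] is normal. *)
Lemma exists_dominated_complement (f : {scalar M}) (C : R) :
  (forall x, vpos x -> 0 <= f x) -> 0 <= C ->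
  exists q, [/\ vpos q, vpos (1 - q),
    C * complex.Re (tr q) <= complex.Re (f q) &
    forall y, vpos y -> vpos (1 - q - y) ->
      complex.Re (f y) <= C * complex.Re (tr y)].
Proof.
move=> f_ge0 C0.
pose g (x : M) := complex.Re (f x) - C * complex.Re (tr x).
have gD x y : g (x + y) = g x + g y.
  rewrite /g !linearD /=; case: (f x) => ? ?; case: (f y) => ? ?.
  by case: (tr x) => ? ?; case: (tr y) => ? ? /=; ring.
have g0 : g 0 = 0 by rewrite /g !linear0 /= mulr0 subr0.
pose S (q : M) := [/\ vpos q, vpos (1 - q) & 0 <= g q].
(* Requiring [g] to increase as well is what keeps [0 <= g] at the supremum of a chain. *)
pose r (s t : {q | S q}) :=
  `[< vle (sval s) (sval t) /\ g (sval s) <= g (sval t) >].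
have S0 : S 0.
  by split; [exact: vpos0 | rewrite subr0; exact: vpos1 | rewrite g0].
have [||||[q [q0 q1 gq]] q_max] := @Zorn {q | S q} r.
- by move=> s; apply/asboolP; split=> //; exact: vle_refl.
- move=> a b c /asboolP[ab gab] /asboolP[bc gbc]; apply/asboolP; split.
    exact: vle_trans bc.
  exact: le_trans gbc.
- move=> [s hs] [t ht] /asboolP[/= st _] /asboolP[/= ts _].
  have e := vle_anti st ts; move: hs; rewrite e => hs.
  by congr exist; exact: Prop_irrelevance.
- move=> A A_tot.
  have [A0|/set0P[a Aa]] := eqVneq A set0.
    by exists (exist _ 0 S0) => s; rewrite A0.
  pose D := sval @` A.
  have hD : updirected (@vle R M) D.
    split; first by exists (sval a), a.
    move=> _ _ [x Ax <-] [y Ay <-]; 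
    have [|] := A_tot x y Ax Ay => /asboolP[xy _].
      by exists (sval y); split=> //; [exists y | exact: vle_refl].
    by exists (sval x); split=> //; [exists x | exact: vle_refl].
  have D1 d : D d -> vle d 1 by move=> [[x [? ? ?]] _ <-].
  have [t ht _] := vigier hD D1.
  have Dstar : D `<=` [set x | star x = x].
    by move=> _ [[x [? ? ?]] _ <-]; exact: vpos_star.
  have gt b : A b -> g (sval b) <= g t.
    move=> Ab; apply/ler_addgt0Pr => e e0.
    have e1 : 0 < e / (C + 1) by rewrite divr_gt0// ltr_wpDl.
    have [_ [c Ac <-] hc] := tr_sup_near Dstar hD ht e1.
    (* The larger of [b] and [c]: going up the chain raises [g] and shrinks the trace gap to [t]. *)
    have [d [Ad gbd htd]] : exists d, [/\ A d, g (sval b) <= g (sval d) &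
        complex.Re (tr (t - sval d)) < e / (C + 1)].
      have [|] := A_tot b c Ab Ac => /asboolP[le_bc gbc]; first by exists c.
      exists b; split=> //; apply: le_lt_trans hc.
      apply: (re_functional_le (@tr_ge0 R M)).
      by rewrite /vle opprB addrC subrKA.
    (* It remains to see [- e <= g (t - d)]: positivity of [f] drops its term, and [C] times the
       trace gap is at most [e]. The denominator [C + 1] covers [C = 0]. *)
    apply: (le_trans gbd); rewrite -[t](subrK (sval d)) gD addrAC lerDr.
    have fp : 0 <= complex.Re (f (t - sval d)).
      have /f_ge0 : vpos (t - sval d) by apply: ht.1; exists d.
      by rewrite lecE => /andP[].
    have : C * complex.Re (tr (t - sval d)) <= C * (e / (C + 1)).
      by rewrite ler_wpM2l// ltW.
    have : C * (e / (C + 1)) <= e.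
      rewrite mulrCA ler_piMr ?(ltW e0)//.
      by rewrite ler_pdivrMr ?ltr_wpDl// mul1r lerDl.
    rewrite /g; lra.
  have St : S t.
    case: a Aa => [a [a0 a1 ga]] Aa; split; last exact: le_trans (gt _ Aa).
      rewrite -(subrK a t); apply: vposD => //; apply: ht.1.
      by exists (exist _ a (And3 a0 a1 ga)).
    exact: ht.2.
  exists (exist _ t St) => b Ab; apply/asboolP; split=> /=; last exact: gt.
  by apply: ht.1; exists b.
exists q; split=> //; first by rewrite -subr_ge0.
(* A violating [y] has [0 < g y], so [q + y] is admissible and above [q]; maximality forces [y = 0],
   hence [g y = 0]. *)
move=> y y0 qy; rewrite leNgt; apply/negP => gy.
have gy0 : 0 < g y by rewrite subr_gt0.
have Sqy : S (q + y).
  split; [exact: vposD | by rewrite opprD addrA|].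
  by rewrite gD addr_ge0// ltW.
have /(congr1 sval)/= : exist S (q + y) Sqy = exist S q (And3 q0 q1 gq).
  apply: q_max; apply/asboolP; split=> /=; last by rewrite gD lerDl ltW.
  by rewrite /vle addrC addKr.
rewrite -[RHS]addr0 => /addrI y_eq0.
by move: gy0; rewrite y_eq0 g0 ltxx.
Qed.

End Trace.

(** * Compressions dominated by the trace are normal *)

(** From [x <= N] follows [b * x * b <= N *: (b * b) <= N *: b]. The hypothesis thus applies to
    [b * x * b] divided by [N], and the bound is homogeneous. *)
Lemma dominated_conj (R : realType) (M : tracialVNA R) (f : {scalar M}) (C : R)
    (b x : M) :
  vpos b -> vpos (1 - b) ->
  (forall y, vpos y -> vpos (b - y) ->
    complex.Re (f y) <= C * complex.Re (tr y)) ->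
  vpos x ->
  complex.Re (f (star b * x * b)) <= C * complex.Re (tr (star b * x * b)).
Proof.
move=> b0 b1 hb x0; pose N := vnorm x + 1.
have N0 : 0 < N by rewrite ltr_wpDl ?vnorm_ge0.
have bxb0 : vpos (star b * x * b) := vpos_conj b x0.
have h : vpos (b - (N^-1)%:C *: (star b * x * b)).
  have -> : b - (N^-1)%:C *: (star b * x * b) =
      (1%:C *: b - b * b) + (N^-1)%:C *: (star b * (N%:C *: 1 - x) * b).
    rewrite mulrBr mulrBl scalerBr -scalerAr -scalerAl scalerA -rmorphM /=.
    by rewrite mulVf ?gt_eqF// !scale1r mulr1 (vpos_star b0) addrA subrK.
  apply: vposD; first by apply: vpos_sqr_bound => //; rewrite scale1r.
  apply: vposZ; first by rewrite invr_ge0 ltW.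
  apply: vpos_conj.
  by apply: vpos_scalar_sub; [exact: vpos_star | rewrite lerDl].
have := hb _ (vposZ (ltW (etrans (invr_gt0 _) N0)) bxb0) h.
rewrite !linearZ /=; case: (f _) => ? ?; case: (tr _) => ? ? /=.
rewrite !mul0r !subr0 mulrCA ler_pM2l ?invr_gt0//.
Qed.

Section Compression.
Variables (R : realType) (M N : vnAlgebra R) (b : M) (phi : {linear M -> N}).

Definition compression x := phi (star b * x * b).

Fact compression_linear : linear compression.
Proof.
by move=> a x y; rewrite /compression mulrDr mulrDl -scalerAr -scalerAl linearP.
Qed.

HB.instance Definition _ :=
  GRing.isLinear.Build R[i] M N _ compression compression_linear.

End Compression.

(** Let [t] be the supremum of the images, which lies below the image of [s]. For [d] in [D], the
    trace of the gap is at most [C] times the trace of [star b * (s - d) * b], arbitrarily small by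
    [conj_sup] and normality of [tr]. Faithfulness closes the gap. *)
Lemma compression_normal (R : realType) (M N : tracialVNA R) (b : M)
    (phi : {linear M -> N}) (C : R) :
  positive_map phi ->
  (forall x, vpos x -> complex.Re (tr (phi (star b * x * b))) <=
    C * complex.Re (tr (star b * x * b))) ->
  normal_map (compression b phi).
Proof.
move=> phi_pos hC D s Dstar hD hs.
have mono : {homo compression b phi : x y / vle x y}.
  by move=> x y xy; rewrite /vle -linearB; apply/phi_pos/vpos_conj.
have hDb := updirected_image (conj_vle b) hD.
have Dbstar : (fun x => star b * x * b) @` D `<=` [set x | star x = x].
  by move=> _ [d /Dstar /= sd <-]; rewrite /= !starM starK sd mulrA.
have ub x : (compression b phi @` D) x -> vle x (compression b phi s).
  by move=> [d Dd <-]; apply/mono/hs.1.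
have [t [t_ub t_le] _] := vigier (updirected_image mono hD) ub.
have ts := t_le _ ub.
suff st : compression b phi s = t by split=> // u hu; rewrite st; exact: t_le.
apply/eqP; rewrite -subr_eq0; apply/eqP/tr_faithful => //.
have tr0 := tr_ge0 ts.
suff : complex.Re (tr (compression b phi s - t)) <= 0.
  move: tr0; case: (tr _) => a a'; rewrite lecE /= => /andP[/eqP -> a0] a1.
  by apply/eqP; rewrite eq_complex /= eqxx andbT eq_le a0 a1.
apply/ler_addgt0Pr => e e0; rewrite add0r.
have e1 : 0 < e / (`|C| + 1) by rewrite divr_gt0// ltr_wpDl.
have [_ [d Dd <-] hd] := tr_sup_near Dbstar hDb (conj_sup b hD hs) e1.
have td : vle (compression b phi s - t)
    (compression b phi s - compression b phi d).
  by rewrite /vle opprB addrC subrKA; apply: t_ub; exists d.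
apply: le_trans (re_functional_le (@tr_ge0 R N) td) _.
rewrite -linearB; apply: le_trans (hC _ (hs.1 d Dd)) _.
rewrite mulrBr mulrBl.
have r0 : 0 <= complex.Re (tr (star b * s * b - star b * d * b)).
  rewrite -mulrBl -mulrBr.
  by have := tr_ge0 (vpos_conj b (hs.1 d Dd)); rewrite lecE => /andP[].
apply: le_trans (ler_wpM2r r0 (ler_norm C)) _.
apply: (@le_trans _ _ (`|C| * (e / (`|C| + 1)))).
  by rewrite ler_wpM2l// ltW.
by rewrite mulrCA ler_piMr ?(ltW e0)// ler_pdivrMr ?ltr_wpDl// mul1r lerDl.
Qed.

(** * Trace estimates and the new lift *)

(** By freeness each number is missed by some member of [U]; intersecting one such member per number
    below [n] leaves only indices from [n] on. *)
Lemma free_ultrafilter_gt (U : set_system nat) (hU : UltraFilter U) (n : nat) :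
  \bigcap_(A in U) A = set0 -> \forall i \near U, (n <= i)%N.
Proof.
move=> hfree; elim: n => [|n IH]; first exact: nearW.
have [A UA nA] : exists2 A, U A & ~ A n.
  apply: contrapT => h; suff : (\bigcap_(A in U) A) n by rewrite hfree.
  by move=> A UA; apply: contrapT => nA; apply: h; exists A.
apply: filterS2 IH UA => i; rewrite leq_eqVlt => /predU1P[<- //|//].
Qed.

Lemma re_tr_le_vnorm (R : realType) (M : tracialVNA R) (x : M) :
  complex.Re (tr x) <= vnorm x.
Proof.
apply: le_trans (Re_le_norm _) _.
rewrite -ler_sqr ?nnegrE ?vnorm_ge0 ?Re_norm_ge0//.
apply: le_trans (tr_le_sqnorm2 _) _.
by have := sqnorm2Ml x 1; rewrite sqnorm2_1 !mulr1.
Qed.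

Lemma vnorm_le1 (R : realType) (M : vnAlgebra R) (x : M) :
  vpos x -> vpos (1 - x) -> vnorm x <= 1.
Proof.
move=> x0 x1; apply: vnorm_le_bound => // v.
by apply: vpos_rnorm_le => //; rewrite scale1r.
Qed.

(** A positive contraction satisfies [x * x <= x]. *)
Lemma sqnorm2_le_tr (R : realType) (M : tracialVNA R) (x : M) :
  vpos x -> vpos (1 - x) -> sqnorm2 x <= complex.Re (tr x).
Proof.
move=> x0 x1; rewrite /sqnorm2 (vpos_star x0).
apply: (re_functional_le (@tr_ge0 R M)); rewrite /vle -[x in x - _]scale1r.
by apply: vpos_sqr_bound => //; rewrite scale1r.
Qed.

Theorem lemma4p2 (R : realType) (U : set_system nat) (hU : UltraFilter U)
    (hfree : \bigcap_(A in U) A = set0)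
    (M : nat -> tracialVNA R) (hsep : forall i, separable (M i))
    (alpha : {lrmorphism ultraproduct U M -> ultraproduct U M})
    (halpha : trace_preserving_automorphism alpha)
    (phi : forall i, {linear M i -> M i})
    (hphi_pos : forall i, positive_map (phi i))
    (hphi_bdd : uniformly_bounded (fun i => phi i))
    (hphi_lift : lifts_to alpha (fun i => phi i)) :
  exists psi : forall i, {linear M i -> M i},
    [/\ forall i, positive_map (psi i),
        forall i, normal_map (psi i),
        uniformly_bounded (fun i => psi i) &
        lifts_to alpha (fun i => psi i)].
Proof.
have [K hK] := hphi_bdd.
have trphi_ge0 i x : vpos x -> 0 <= (tr \o phi i) x.
  by move=> x0; apply/tr_ge0/hphi_pos.
pose Q i := cid (exists_dominated_complement (@trphi_ge0 i) (ler0n R i)).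
pose q i : M i := sval (Q i); pose b i : M i := 1 - q i.
have q0 i : vpos (q i) by rewrite /q; case: (svalP (Q i)).
have b0 i : vpos (b i) by rewrite /b /q; case: (svalP (Q i)).
have q_b i : 1 - b i = q i by rewrite /b subKr.
have b1 i : vpos (1 - b i) by rewrite q_b.
have b_le1 i : vnorm (b i) <= 1 by exact: vnorm_le1.
pose B := BoundedSeq
  (ex_intro (fun K : R => forall i, vnorm (b i) <= K) 1 b_le1).
(* The chain is [i * sqnorm2 q <= i * tr q <= tr (phi q) <= tr (phi 1) <= vnorm (phi 1) <= |K|], on
   real parts of traces. *)
have q_le i : i%:R * sqnorm2 (q i) <= `|K|.
  apply: (@le_trans _ _ (i%:R * complex.Re (tr (q i)))).
    by rewrite ler_wpM2l// sqnorm2_le_tr.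
  apply: (@le_trans _ _ (complex.Re ((tr \o phi i) (q i)))).
    by rewrite /q; case: (svalP (Q i)).
  apply: le_trans (re_functional_le (@trphi_ge0 i) (b0 i)) _.
  apply: le_trans (re_tr_le_vnorm _) _; apply: le_trans (hK _ _) _.
  apply: le_trans (ler_wpM2r (vnorm_ge0 _) (ler_norm K)) _.
  by rewrite ler_piMr// vnorm1.
have B1 : ultra_class U B = 1.
  apply/ultra_classP/ultra_equivP => e e0.
  (* Beyond this index [|K| / i <= e]; the successor ensures that [i] is nonzero. *)
  have := free_ultrafilter_gt hU (Num.bound (`|K| / e)).+1 hfree.
  apply: filterS => i /= hi.
  rewrite -opprB sqnorm2N q_b.
  have i0 : (0 : R) < i%:R by rewrite ltr0n (leq_ltn_trans _ hi).
  rewrite -(ler_pM2l i0); apply: le_trans (q_le i) _.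
  rewrite -ler_pdivrMr//; apply: ltW; apply: lt_le_trans (archi_boundP _) _.
    by rewrite divr_ge0// ltW.
  by rewrite ler_nat ltnW.
exists (fun i => compression (b i) (phi i)); split.
- by move=> i x x0; apply/hphi_pos/vpos_conj.
- move=> i; apply: (compression_normal (C := i%:R)) => // x x0.
  apply: (dominated_conj (f := tr \o phi i)) => //.
  by rewrite /b /q; case: (svalP (Q i)).
- exists `|K| => i x; apply: le_trans (hK _ _) _.
  apply: le_trans (ler_wpM2r (vnorm_ge0 _) (ler_norm K)) _.
  rewrite ler_wpM2l//; apply: le_trans (vnormM _ _) _.
  rewrite -[leRHS]mulr1 ler_pM ?vnorm_ge0//; apply: le_trans (vnormM _ _) _.
  by rewrite ler_piMl ?vnorm_ge0// (vpos_star (b0 i)).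
(* Applying [phi] to the compressed sequence is applying the new maps to [x], and the compressed
   sequence has the class of [x] because [B] has class [1]. *)
move=> x; have [z hz hxz] := hphi_lift (bseq_mul (bseq_mul (bseq_star B) x) B).
exists z; first exact: hz.
rewrite -hxz.
have -> : bseq_star B = B by apply: bseq_ext => i /=; exact: vpos_star.
by rewrite -!ultra_mulE B1 [ultra_mul _ 1]ultra_mul1r
  [ultra_mul 1 _]ultra_mul1l.
Qed.
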